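(* Let $\Gamma$ be a finitely generated group with finite generating set $S$, acting by left translation on $X=\operatorname{Cay}(\Gamma,S)$. Then $\Gamma$ is hyperbolic if and only if there exist $\rho>0$ and an increasing sequence of positive integers $m_k\to\infty$ with $$\sup_k\frac{m_{k+1}}{m_k}<\infty$$ such that the Cayley action has the $(\rho,m_k)$-Cotlar property for every $k$.
   Context: The Cayley graph $X$ is viewed as a geodesic metric space with every edge of length one. $e$ is the identity, $|g|=\operatorname{dist}(e,g)$ is the word length, $S_m(e)=\{x\in X:\operatorname{dist}(x,e)=m\}$, $B_r(a)=\{x:\operatorname{dist}(x,a)<r\}$ for $r>0$ and $B_0(a)=\{a\}$. $\Gamma$ is hyperbolic if $X$ is $\delta$-hyperbolic for some $\delta$, i.e. every side of every geodesic triangle lies in the open $\delta$-neighborhood of the union of the other two sides. For $A\subset X$ and $r\ge0$, $\mathcal L^{\exists}_A=\{g\in\Gamma:\text{some geodesic from } e \text{ to } g \text{ meets } A\}$ and $\mathcal L^{\forall,r}_A=\{g\in\Gamma:\text{there exists } a\in A \text{ such that every geodesic from } e\text{ to } g\text{ meets } B_r(a)\}$. $\lambda$ is the left regular representation of $\Gamma$; for $\mathcal E\subset\Gamma$, $P_{\mathcal E}$ is the Fourier projection with $P_{\mathcal E}\lambda_g=\lambda_g$ if $g\in\mathcal E$ and $0$ otherwise; $\mathcal E^{-1}=\{g^{-1}:g\in\mathcal E\}$. For $\mathcal A=(A_i)_{i\in I}$ and finitely supported $\varepsilon=(\varepsilon_i)$ with $|\varepsilon_i|\le1$, $$\mathcal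 H^{\exists}_{\mathcal A,\varepsilon}=\sum_i\varepsilon_iP_{\mathcal L^{\exists}_{A_i}},\quad (\mathcal H^{\exists}_{\mathcal A,\varepsilon})^\circ=\sum_i\overline{\varepsilon_i}P_{(\mathcal L^{\exists}_{A_i})^{-1}},\quad \mathcal H^{\forall,r}_{\mathcal A,\varepsilon}=\sum_i\varepsilon_iP_{\mathcal L^{\forall,r}_{A_i}},\quad (\mathcal H^{\forall,r}_{\mathcal A,\varepsilon})^\circ=\sum_i\overline{\varepsilon_i}P_{(\mathcal L^{\forall,r}_{A_i})^{-1}}.$$ Cotlar property: for $\rho\ge0$ and $m\in\mathbb N$, the Cayley action has the $(\rho,m)$-Cotlar property if, for every finite family $(A_i)$ of subsets of $S_m(e)$ with pairwise disjoint branches $\mathcal L^{\forall,\rho}_{A_i}$, every finitely supported coefficient family $(\varepsilon_i)$ with $|\varepsilon_i|\le1$, and all $g,h\in\bigcup_i\mathcal L^{\exists}_{A_i}$ satisfying $|gh^{-1}|\ge2m+2\rho$, one has, with $H^{\exists}=\mathcal H^{\exists}_{\mathcal A,\varepsilon}$ and $H^{\forall}=\mathcal H^{\forall,\rho}_{\mathcal A,\varepsilon}$, $$H^{\exists}(\lambda_g)(H^{\exists})^\circ(\lambda_{h^{-1}})=H^{\forall}\big(\lambda_g(H^{\forall})^\circ(\lambda_{h^{-1}})\big)+(H^{\forall})^\circ\big(H^{\forall}(\lambda_g)\lambda_{h^{-1}}\big)-(H^{\forall})^\circ H^{\forall}(\lambda_g\lambda_{h^{-1}}).$$ *)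

(* Defs.v *)
From HB Require Import structures.
From mathcomp Require Import all_boot all_order all_algebra.
From mathcomp Require Import all_classical all_reals all_analysis.
From mathcomp Require Import complex ring.

Set Implicit Arguments.
Unset Strict Implicit.
Unset Printing Implicit Defensive.

Import Order.TTheory GRing.Theory Num.Theory.

Local Open Scope classical_set_scope.
Local Open Scope ring_scope.

Definition generates (G : groupType) (S : set G) : Prop :=
  forall H : {pred G}, group_closed H -> {in S, forall s, s \in H} ->
  forall g, g \in H.

Section CayleyGraph.
Variables (R : realType) (G : groupType) (S : set G).

(* Cay(G, S) is taken as a simple undirected graph: no loop when 1 \in S and no
   double edge when S contains both s and s^-1. *)
Definition cay_adj (u v : G) : Prop :=
  u <> v /\ exists2 s, S s & v = (u * s)%g \/ u = (v * s)%g.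

(* Geometric realization: a point is given by its barycentric coordinates, so
   that the endpoints shared by several edges are equal as points. *)
Definition on_edge_at (u v : G) (t : R) : G -> R :=
  fun w => (1 - t) * (w == u)%:R + t * (w == v)%:R.

Record cayley := CayleyPoint {
  bary :> G -> R ;
  _ : exists u v t, [/\ u = v \/ cay_adj u v, 0 <= t <= 1
                      & bary = on_edge_at u v t] }.

Fact vertex_subproof (g : G) : exists u v (t : R),
  [/\ u = v \/ cay_adj u v, 0 <= t <= 1 & on_edge_at g g 0 = on_edge_at u v t].
Proof. by exists g, g, 0; split; [left | rewrite lexx ler01 | ]. Qed.

Definition vertex (g : G) : cayley := CayleyPoint (vertex_subproof g).

Definition on_edge (u v : G) (x : cayley) : Prop :=
  cay_adj u v /\ exists2 t, 0 <= t <= 1 & bary x = on_edge_at u v t.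

(* Polygonal paths and their lengths: each step stays inside one closed edge,
   which is isometric to [0, 1] through the coordinate at either endpoint. *)
Inductive path_length : cayley -> cayley -> R -> Prop :=
| PathNil x : path_length x x 0
| PathStep x y z u v l : on_edge u v x -> on_edge u v y ->
    path_length y z l -> path_length x z (`|x u - y u| + l).

Definition dist (x y : cayley) : R := inf [set l | path_length x y l].

Definition len (g : G) : R := dist (vertex 1%g) (vertex g).

Definition sphere (m : nat) : set cayley :=
  [set x | dist x (vertex 1%g) = m%:R].

Definition gball (r : R) (a : cayley) : set cayley :=
  if r == 0 then [set a] else [set x | dist x a < r].

Definition is_geodesic (x y : cayley) (gam : R -> cayley) : Prop :=
  [/\ gam 0 = x, gam (dist x y) = y &
      {in `[0, dist x y] &, forall s t, dist (gam s) (gam t) = `|s - t|}].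

Definition geodesic_segment (x y : cayley) (sigma : set cayley) : Prop :=
  exists2 gam, is_geodesic x y gam & sigma = gam @` `[0, dist x y].

Definition nbhd (delta : R) (A : set cayley) : set cayley :=
  [set x | exists2 a, A a & dist x a < delta].

Definition delta_hyperbolic (delta : R) : Prop :=
  forall x y z s1 s2 s3,
    geodesic_segment x y s1 -> geodesic_segment y z s2 ->
    geodesic_segment z x s3 ->
    [/\ s1 `<=` nbhd delta (s2 `|` s3),
        s2 `<=` nbhd delta (s3 `|` s1) &
        s3 `<=` nbhd delta (s1 `|` s2)].

Definition hyperbolic : Prop := exists delta, delta_hyperbolic delta.

Definition branch_ex (A : set cayley) : set G :=
  [set g | exists2 sigma, geodesic_segment (vertex 1%g) (vertex g) sigma
                        & sigma `&` A !=set0].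

Definition branch_all (r : R) (A : set cayley) : set G :=
  [set g | exists2 a, A a & forall sigma,
     geodesic_segment (vertex 1%g) (vertex g) sigma ->
     sigma `&` gball r a !=set0].

End CayleyGraph.

Section LeftRegular.
Variables (R : realType) (G : groupType).
Local Notation C := (R[i])%C.

Definition square_summable : {pred G -> C^o} := fun xi =>
  `[< exists M : C, forall s : seq G, uniq s ->
        \sum_(x <- s) `|xi x| ^+ 2 <= M >].

Fact square_summable_submod : submod_closed square_summable.
Proof.
split.
  apply/asboolP; exists 0 => s _.
  by rewrite big1// => x _; rewrite normr0 expr0n.
move=> a xi eta /asboolP[M HM] /asboolP[N HN]; apply/asboolP.
exists (2 * (`|a| ^+ 2 * M + N)) => s us.
apply: (@le_trans _ _ (2 * (`|a| ^+ 2 * (\sum_(x <- s) `|xi x| ^+ 2)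
                           + \sum_(x <- s) `|eta x| ^+ 2))); last first.
  rewrite ler_wpM2l ?ler0n// lerD ?HN//.
  by rewrite ler_wpM2l ?exprn_ge0 ?HM.
rewrite mulr_sumr -big_split mulr_sumr; apply: ler_sum => x _ /=.
have h : `|(a *: xi + eta) x| <= `|a| * `|xi x| + `|eta x|.
  by rewrite -normrM; exact: ler_normD.
apply: le_trans (lerXn2r 2 _ _ h) _; rewrite ?nnegrE ?addr_ge0 ?mulr_ge0//.
rewrite -exprMn; set p := `|a| * _; set q := `|eta x|.
rewrite -subr_ge0.
have -> : 2 * (p ^+ 2 + q ^+ 2) - (p + q) ^+ 2 = (p - q) ^+ 2 by ring.
apply: real_exprn_even_ge0 => //; apply: realB; apply: ger0_real.
  exact: mulr_ge0.
exact: normr_ge0.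
Qed.

HB.instance Definition _ :=
  GRing.isSubmodClosed.Build C (G -> C^o) square_summable
    square_summable_submod.

Record l2 := L2 { l2val :> G -> C^o; _ : l2val \in square_summable }.

HB.instance Definition _ := [isSub for l2val].
HB.instance Definition _ := [Choice of l2 by <:].
HB.instance Definition _ := [SubChoice_isSubLmodule of l2 by <:].

Fact delta_subproof (g : G) :
  ((fun h => (h == g)%:R) : G -> C^o) \in square_summable.
Proof.
apply/asboolP; exists 1 => s us.
apply: (@le_trans _ _ (\sum_(x <- s | x == g) (1 : C))).
  rewrite [leRHS]big_mkcond/=; apply: ler_sum => x _.
  by case: eqP => _; rewrite ?normr1 ?normr0 ?expr1n ?expr0n.
have [gs|gs] := boolP (g \in s).
  by rewrite -big_filter (filter_pred1_uniq us gs) big_seq1.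
rewrite big_seq_cond big1 ?ler01// => x /andP[xs /eqP xg].
by rewrite -xg xs in gs.
Qed.

Definition delta_fun (g : G) : l2 := L2 (delta_subproof g).

Fact lambda_subproof (g : G) (xi : l2) :
  ((fun h => xi (g^-1 * h)%g) : G -> C^o) \in square_summable.
Proof.
case: xi => xi /= /asboolP[M HM]; apply/asboolP; exists M => s us.
rewrite -(big_map (fun h => g^-1 * h)%g xpredT (fun x => `|xi x| ^+ 2)).
by apply: HM; rewrite map_inj_uniq//; exact: mulgI.
Qed.

Definition lambda (g : G) : l2 -> l2 := fun xi => L2 (lambda_subproof g xi).

Lemma lambdaM (g h : G) : lambda g \o lambda h = lambda (g * h)%g.
Proof.
apply/funext => xi; apply/val_inj/funext => x /=.
by rewrite invgM mulgA.
Qed.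

(* T = \sum_g (fourier_coef T g) *: lambda g on the linear span of the lambda g. *)
Definition fourier_coef (T : l2 -> l2) (g : G) : C := T (delta_fun 1%g) g.

(* Meaningful on the linear span of the lambda g, where the sum has finite
   support; lambda 1 is the identity and operators are multiplied by \o. *)
Definition fourier_proj (E : set G) (T : l2 -> l2) : l2 -> l2 :=
  \sum_(g \in E) fourier_coef T g *: lambda g.

Lemma fourier_coef_lambda c g h :
  fourier_coef (c *: lambda g) h = c * (h == g)%:R.
Proof.
rewrite /fourier_coef /=.
change (c * ((g^-1 * h)%g == 1%g)%:R = c * (h == g)%:R).
by congr (_ * (nat_of_bool _)%:R); rewrite -(inj_eq (mulgI g) (g^-1 * h)%g) mulVKg mulg1.
Qed.

Lemma fourier_proj_lambda E c g :
  fourier_proj E (c *: lambda g) = if g \in E then c *: lambda g else 0.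
Proof.
rewrite /fourier_proj fsbig_mkcond -(fsbig_widen [set g]) //=.
  by rewrite fsbig_set1 /patch fourier_coef_lambda eqxx mulr1.
move=> h /= [_ /eqP/negPf hg]; rewrite /patch fourier_coef_lambda hg mulr0 scale0r.
by case: ifP.
Qed.

End LeftRegular.

Section Cotlar.
Variables (R : realType) (G : groupType) (S : set G).
Local Notation C := (R[i])%C.

Definition hilbert_transform (I : finType) (L : I -> set G) (eps : I -> C)
    (T : l2 R G -> l2 R G) : l2 R G -> l2 R G :=
  \sum_(i : I) eps i *: fourier_proj (L i) T.

Definition hilbert_transform_circ (I : finType) (L : I -> set G) (eps : I -> C)
    (T : l2 R G -> l2 R G) : l2 R G -> l2 R G :=
  \sum_(i : I) (eps i)^* *: fourier_proj [set (g^-1)%g | g in L i] T.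

Definition cotlar_property (rho : R) (m : nat) : Prop :=
  forall (I : finType) (A : I -> set (cayley R S)) (eps : I -> C),
    (forall i, A i `<=` sphere m) ->
    trivIset setT (fun i => branch_all rho (A i)) ->
    (forall i, `|eps i| <= 1) ->
    let Hex := hilbert_transform (fun i => branch_ex (A i)) eps in
    let Hexo := hilbert_transform_circ (fun i => branch_ex (A i)) eps in
    let Hall := hilbert_transform (fun i => branch_all rho (A i)) eps in
    let Hallo := hilbert_transform_circ (fun i => branch_all rho (A i)) eps in
    forall g h : G,
      (\bigcup_i branch_ex (A i)) g -> (\bigcup_i branch_ex (A i)) h ->
      2 * m%:R + 2 * rho <= len R S (g * h^-1)%g ->
      Hex (lambda g) \o Hexo (lambda h^-1%g) =
        Hall (lambda g \o Hallo (lambda h^-1%g))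
        + Hallo (Hall (lambda g) \o lambda h^-1%g)
        - Hallo (Hall (lambda g \o lambda h^-1%g)).

End Cotlar.

(* Main.v *)
Require Import Defs.
From mathcomp Require Import all_boot all_order all_algebra.
From mathcomp Require Import all_classical all_reals all_analysis.
From mathcomp Require Import complex ring lra zify.

(** On monomials the Cotlar identity becomes a scalar identity between the
    symbols [c(g) = \sum_(i | g \in L i) eps i] of the two multipliers.

    Hyperbolic implies Cotlar, at every scale [m]: for [rho >= delta] the two
    symbols agree at [g] and [h], and with [k = g h^-1] the Gromov products of
    the triangle [1, g, k] based at [1] and at [k] add up to
    [|k| >= 2 m + 2 rho].  If the first is at least [m + rho], then [k] lies in
    the branch of [g]; otherwise [k^-1] lies in the branch of [h].

    Conversely, the identity for one- and two-element families says that, in a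
    triangle [x, y, z] with [d x z >= 2 m + r], a geodesic [x, z] passes within
    [r] of the point at distance [m] from [x] on [x, y], or of the point at
    distance [m] from [z] on [z, y] ([cotlar_scale]).  If this holds for
    arbitrarily large [m], then geodesics with close ends are uniformly close:
    let [p'] start near [a]; the defect [d a (p' s) - s] is monotone, integral
    and bounded, hence constant on a long interval, on which [p'] continues a
    geodesic from [a]; comparing the latter with [p] gives a cut point, and one
    inducts on the length.  Finally, in a triangle with base [x, z], shrink the
    base around a given point to the maximal subsegment that is far from the
    other sides; the property at a fixed scale [m] bounds its length. *)

Set Implicit Arguments.
Unset Strict Implicit.
Unset Printing Implicit Defensive.

Import Order.TTheory GRing.Theory Num.Theory.

(** * Discrete geodesic spaces *)

Section DiscreteGeodesic.
Variables (V : Type) (d : V -> V -> nat).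

Definition path_geodesic (p : nat -> V) (n : nat) (x y : V) : Prop :=
  [/\ p 0 = x, p n = y & forall i j, i <= j <= n -> d (p i) (p j) = j - i].

Definition geodesic_metric : Prop :=
  [/\ forall x, d x x = 0, forall x y, d x y = d y x,
      forall x y z, d x z <= d x y + d y z
    & forall x y, exists p, path_geodesic p (d x y) x y].

(** Lying on a side is expressed by equality in the triangle inequality, so [a] and [b] may be taken
    on any geodesics from [x] and from [z] to [y]. *)
Definition cotlar_scale (r m : nat) : Prop :=
  forall x y z a b p n,
    d x a = m -> d x a + d a y = d x y -> d z b = m -> d z b + d b y = d z y ->
    2 * m + r <= d x z -> path_geodesic p n x z ->
  exists2 i, i <= n & d (p i) a <= r \/ d (p i) b <= r.

Hypothesis gm : geodesic_metric.
Let dxx x : d x x = 0. Proof. by case: gm => h _ _ _; exact: h. Qed.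
Let dC x y : d x y = d y x. Proof. by case: gm => _ h _ _; exact: h. Qed.
Let dT y x z : d x z <= d x y + d y z. Proof. by case: gm => _ _ h _; exact: h. Qed.
Let geo_ex x y : exists p, path_geodesic p (d x y) x y.
Proof. by case: gm => _ _ _ h; exact: h. Qed.

Lemma path_geodesic_len p n x y : path_geodesic p n x y -> d x y = n.
Proof. by case=> <- <- h; rewrite h ?leqnn//= subn0. Qed.

Lemma path_geodesic_from p n x y i : path_geodesic p n x y -> i <= n -> d x (p i) = i.
Proof. by case=> <- _ h il; rewrite h ?subn0. Qed.

Lemma path_geodesic_to p n x y i :
  path_geodesic p n x y -> i <= n -> d (p i) y = n - i.
Proof. by case=> _ <- h il; rewrite h ?il /=. Qed.

Lemma path_geodesic_rev p n x y :
  path_geodesic p n x y -> path_geodesic (fun i => p (n - i)) n y x.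
Proof.
case=> hx hy h; split; rewrite ?subn0 ?subnn// => i j ij.
by rewrite dC h; lia.
Qed.

Lemma path_geodesic_sub p n x y i j : path_geodesic p n x y -> i <= j <= n ->
  path_geodesic (fun k => p (i + k)) (j - i) (p i) (p j).
Proof.
case=> hx hy h ij; split; rewrite ?addn0 ?subnKC//; first by case/andP: ij.
by move=> k l kl; rewrite h; lia.
Qed.

Lemma path_geodesic_cat p n q l x y z :
  path_geodesic p n x y -> path_geodesic q l y z -> d x z = n + l ->
  path_geodesic (fun i => if i <= n then p i else q (i - n)) (n + l) x z.
Proof.
move=> [px py hp] [qy qz hq] dxz; split.
- by rewrite leq0n px.
- case: ifP => [|_]; last by rewrite addKn.
  move=> h; have l0 : l = 0 by lia.
  by rewrite l0 addn0 py -qy -qz l0.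
- move=> i j /andP[ij jn].
  case: ifP => [ii|/negbT ii]; case: ifP => [jj|/negbT jj].
  + by rewrite hp//; lia.
  + apply/eqP; rewrite eqn_leq; apply/andP; split.
      apply: leq_trans (dT y _ _) _.
      by rewrite -{1}py hp ?ii ?leqnn// -qy hq; lia.
    (* The lower bound: anything shorter between [p i] and [q (j - n)] would contradict
       [d x z = n + l]. *)
    have := dT (p i) x z; have := dT (q (j - n)) (p i) z.
    rewrite -qz -px hp ?ii// hq; last by lia.
    by rewrite px qz; lia.
  + by lia.
  + by rewrite hq; lia.
Qed.

(** * Thin quadrilaterals and triangles from arbitrarily large scales *)

Section Quad.
Variable r : nat.
Hypothesis scales : forall c, exists2 m, c <= m & cotlar_scale r m.

(** Pigeonhole: without a repetition [D] grows by at least one at each step, so [D k.+1] would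
    exceed [k]. *)
Lemma monotone_repeat (D : nat -> nat) k :
  (forall j, j <= k -> D j <= D j.+1) -> D k.+1 <= k ->
  exists2 j, j <= k & D j = D j.+1.
Proof.
move=> mono bd.
have [[j [jk e]]|no] := pselect (exists j, j <= k /\ D j = D j.+1).
  by exists j.
have lo j : j <= k.+1 -> j <= D j.
  elim: j => // j IH jk; apply: leq_ltn_trans (IH (ltnW jk)) _.
  rewrite ltn_neqAle mono// andbT; apply/eqP => e; apply: no.
  by exists j.
by have := leq_trans (lo _ (leqnn _)) bd; rewrite ltnn.
Qed.

(** Two points make this fit for induction: the gap at the cut is at most [r] whatever [K] is, and
    [L0] depends on [K] and not on the geodesics, since the cut is made at one of boundedly many
    scales chosen beforehand. *)
Lemma quad_split K : exists L0, forall p n a b p' n' a' b',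
  path_geodesic p n a b -> path_geodesic p' n' a' b' ->
  d a a' <= K -> d b b' <= K -> L0 <= n ->
  exists m m', [/\ 0 < m <= L0, m < n, m' <= n' & d (p m) (p' m') <= r].
Proof.
have /choice[sc hsc] : forall c, exists m, c <= m /\ cotlar_scale r m.
  by move=> c; have [m cm Tm] := scales c; exists m.
pose mu c := sc (c + 3 * K + 2 * r + 1).
(* The checkpoint following [c] is so far out that, even after a loss of [K], it is at distance at
   least [2 * mu c + r] from [a], as the scale [mu c] requires. *)
pose F c := 2 * mu c + r + K.
pose cs j := iter j F 0.
have muge c : c + 3 * K + 2 * r + 1 <= mu c by case: (hsc (c + 3 * K + 2 * r + 1)).
have csS j : cs j.+1 = 2 * mu (cs j) + r + K by [].
have cs_mono i j : i <= j -> cs i <= cs j.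
  elim: j => [|j IH]; first by rewrite leqn0 => /eqP ->.
  rewrite leq_eqVlt => /orP[/eqP -> //|/IH h].
  by apply: leq_trans h _; rewrite csS; have := muge (cs j); lia.
exists (2 * cs (2 * K).+1 + 3 * K + 1) => p n a b p' n' a' b' gp gp' aa bb Ln.
have dab := path_geodesic_len gp; have dab' := path_geodesic_len gp'.
have n'n : n <= n' + 2 * K.
  by have := dT a' a b; have := dT b' a' b; rewrite (dC b' b); lia.
have csn j : j <= (2 * K).+1 -> cs j <= n' by move=> /cs_mono; lia.
have [_ _ hp'] := gp'.
(* By [up] and [lo] the defect lies between [-K] and [K]. Shifted by [K] it is a natural number at
   most [2 * K], so it repeats among the [2 * K + 2] checkpoints. *)
have up s : s <= n' -> d a (p' s) <= K + s.
  move=> sn; have := dT a' a (p' s); rewrite (path_geodesic_from gp' sn); lia.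
have lo s : s <= n' -> s <= d a (p' s) + K.
  move=> sn; have := dT a a' (p' s); rewrite (path_geodesic_from gp' sn) (dC a' a); lia.
(* [j] is such that the defect [s - d a (p' s)] is the same at [cs j] and at
   [cs j.+1]. *)
have [||j jK] := @monotone_repeat (fun j => cs j + K - d a (p' (cs j))) (2 * K).
- move=> j jK; set s := cs j; set s1 := cs j.+1.
  have ss1 : s <= s1 by apply: cs_mono.
  have s1n : s1 <= n' by apply: csn.
  have := dT (p' s) a (p' s1); rewrite hp' ?ss1//.
  have := up s (leq_trans ss1 s1n); have := up s1 s1n; lia.
- have := lo _ (csn _ (leqnn _)); lia.
set s := cs j; set s1 := cs j.+1 => eqD.
have ss1 : s <= s1 by apply: cs_mono.
have s1c : s1 <= cs (2 * K).+1 by apply: cs_mono.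
have s1n : s1 <= n' by apply: csn.
set m := mu s.
have ms : s + 3 * K + 2 * r + 1 <= m := muge s.
have s1E : s1 = 2 * m + r + K by [].
have Tm : cotlar_scale r m by case: (hsc (s + 3 * K + 2 * r + 1)).
have [xi gxi] := geo_ex a (p' s).
have us := up s (leq_trans ss1 s1n); have us1 := up s1 s1n.
have ls := lo s (leq_trans ss1 s1n); have ls1 := lo s1 s1n.
(* Equal defects say exactly that [p'] between [s] and [s1] prolongs a geodesic from [a] to
   [p' s]. *)
have d1E : d a (p' s1) = d a (p' s) + (s1 - s) by lia.
have gsub : path_geodesic (fun k => p' (s + k)) (s1 - s) (p' s) (p' s1).
  by apply: path_geodesic_sub gp' _; rewrite ss1.
have gal := path_geodesic_cat gxi gsub d1E.
set al := (fun i => _) in gal.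
have [be gbe] := geo_ex (p' s1) b.
have fb : m <= d (p' s1) b.
  by have := dT (p' s1) a b; lia.
have apm : d a (p m) = m by apply: path_geodesic_from gp _; lia.
have pmb : d (p m) b = n - m by apply: path_geodesic_to gp _; lia.
have fbe : d (p' s1) (be m) = m by apply: path_geodesic_from gbe _; lia.
have beb : d (be m) b = d (p' s1) b - m by apply: path_geodesic_to gbe _; lia.
have [|||i il [near|near]] := Tm a b (p' s1) (p m) (be m) _ _ apm _ fbe _ _ gal.
- lia.
- lia.
- lia.
(* Here [i >= m - r] exceeds [d a (p' s)], so [al i] lies on the part of [al] taken from [p']. *)
- have ai : d a (al i) = i by exact: path_geodesic_from gal il.
  have im : m <= i + r.
    by have := dT (al i) a (p m); lia.
  exists m, (s + (i - d a (p' s))); split; try lia.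
  by rewrite dC; move: near; rewrite /al ifF//; lia.
(* This alternative is impossible: the way from [a] to [b] through [al i] and [be m] would have
   length at most [n + 4 * K + 2 * r - 2 * m], less than [n]. *)
- have ai : d a (al i) = i by exact: path_geodesic_from gal il.
  have aif : d (al i) (p' s1) = d a (p' s) + (s1 - s) - i.
    by rewrite (path_geodesic_to gal il).
  have := dT (al i) a b; have := dT (be m) (al i) b.
  have := dT (be m) (p' s1) (al i); rewrite dab.
  have := dT (al i) (p' s1) (be m); rewrite (dC (p' s1) (al i)).
  have : d (p' s1) b <= n' - s1 + K.
    have := dT b' (p' s1) b; rewrite (path_geodesic_to gp' s1n) (dC b' b); lia.
  have : n' <= n + 2 * K.
    have := dT a a' b'; have := dT b a b'; rewrite (dC a' a); lia.
  lia.
Qed.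

(** A cut produces two shorter quadrilaterals whose new short side is at most [r], hence at most
    [K], so the constants do not deteriorate along the induction. Below length [L0] the end [a'] is
    close enough. *)
Lemma quad_slim K : r <= K -> exists sigma, forall p n a b p' n' a' b',
  path_geodesic p n a b -> path_geodesic p' n' a' b' ->
  d a a' <= K -> d b b' <= K ->
  forall t, t <= n -> exists2 t', t' <= n' & d (p t) (p' t') <= sigma.
Proof.
move=> rK; have [L0 hL] := quad_split K; exists (L0 + K) => p n.
have [k] := ubnP n; elim: k p n => // k IH p n nk a b p' n' a' b' gp gp' aa bb t tn.
have [p0 pn _] := gp; have [p'0 p'n _] := gp'.
have [Ln|Ln] := leqP L0 n; last first.
  exists 0 => //; have := dT a (p t) a'; rewrite p'0 (dC (p t) a).
  by rewrite (path_geodesic_from gp tn); lia.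
have [m [m' [m0 mn m'n dm]]] := hL _ _ _ _ _ _ _ _ gp gp' aa bb Ln.
have [tm|mt] := leqP t m.
  have g1 : path_geodesic p m a (p m).
    by have := path_geodesic_sub gp (_ : 0 <= m <= n); rewrite subn0 p0; apply; lia.
  have g2 : path_geodesic p' m' a' (p' m').
    by have := path_geodesic_sub gp' (_ : 0 <= m' <= n'); rewrite subn0 p'0; apply; lia.
  have [|t' t'm ht] := IH _ _ _ _ _ _ _ _ _ g1 g2 aa (leq_trans dm rK) t tm; first by lia.
  by exists t' => //; lia.
have g1 : path_geodesic (fun k => p (m + k)) (n - m) (p m) b.
  by rewrite -pn; apply: path_geodesic_sub gp _; lia.
have g2 : path_geodesic (fun k => p' (m' + k)) (n' - m') (p' m') b'.
  by rewrite -p'n; apply: path_geodesic_sub gp' _; lia.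
have [||t' t'm ht] := IH _ _ _ _ _ _ _ _ _ g1 g2 (leq_trans dm rK) bb (t - m); try lia.
by exists (m' + t'); [lia | rewrite subnKC// in ht; lia].
Qed.

(* [sigma] does not depend on [K]: far from its short side, of length at most
   [K], a triangle is as thin as the quadrilaterals with short sides [r]. *)
Lemma corner_slim sigma K L0 m :
  (forall p n a b p' n' a' b',
    path_geodesic p n a b -> path_geodesic p' n' a' b' ->
    d a a' <= r -> d b b' <= r ->
    forall t, t <= n -> exists2 t', t' <= n' & d (p t) (p' t') <= sigma) ->
  (forall p n a b p' n' a' b',
    path_geodesic p n a b -> path_geodesic p' n' a' b' ->
    d a a' <= K -> d b b' <= K -> L0 <= n ->
    exists m m', [/\ 0 < m <= L0, m < n, m' <= n' & d (p m) (p' m') <= r]) ->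
  L0 <= m -> forall p n a y p' n' a',
  path_geodesic p n a y -> path_geodesic p' n' a' y -> d a a' <= K -> m <= n ->
  exists2 t', t' <= n' & d (p m) (p' t') <= sigma.
Proof.
move=> slim split Lm p n a y p' n' a' gp gp' aa mn.
have [|k [k' [k0 kn k'n dk]]] := split _ _ _ _ _ _ _ _ gp gp' aa _ (leq_trans Lm mn).
  by rewrite dxx.
have [_ pn _] := gp; have [_ p'n _] := gp'.
have g1 : path_geodesic (fun i => p (k + i)) (n - k) (p k) y.
  by rewrite -pn; apply: path_geodesic_sub gp _; lia.
have g2 : path_geodesic (fun i => p' (k' + i)) (n' - k') (p' k') y.
  by rewrite -p'n; apply: path_geodesic_sub gp' _; lia.
have [||t' t'm ht] := slim _ _ _ _ _ _ _ _ g1 g2 dk _ (m - k); try lia.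
  by rewrite dxx.
by exists (k' + t'); [lia | rewrite subnKC// in ht; lia].
Qed.

(* [U] is to be the union of two sides of a triangle meeting at [y]. *)
Lemma triangle_slim : exists Delta, forall (U : V -> Prop) x y z p n,
  (forall u, U u -> exists q l, path_geodesic q l u y /\
     forall i, i <= l -> U (q i)) ->
  U x -> U z -> path_geodesic p n x z ->
  forall t, t <= n -> exists2 u, U u & d (p t) u <= Delta.
Proof.
have [sg0 slim0] := quad_slim (leqnn r).
(* The threshold for being near [U]: [r] to reach a point at distance [m] on a side, then [sg0] from
   there to [U] by [corner_slim]. *)
pose N := sg0 + r.
have [L0 splitN] := quad_split N.
(* [m >= L0] is needed by [corner_slim]; [m > r] keeps the point found at the end strictly inside
   the subsegment. *)
have [m mge Tm] := scales (L0 + r + 1).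
have [sg1 slim1] : exists sigma, _ := @quad_slim (maxn m N + r) (leq_addl _ _).
exists (sg1 + N + 2 * m + r) => U x y z p n hU Ux Uz gp t tn.
have [p0 pn hp] := gp.
pose near i := `[< exists2 u, U u & d (p i) u <= N >].
have [/asboolP[u Uu du]|nt] := boolP (near t).
  by exists u => //; lia.
have near0 : near 0 by apply/asboolP; exists x; rewrite // p0 dxx.
have nearn : near n by apply/asboolP; exists z; rewrite // pn dxx.
have exP1 : exists i, near i && (i <= t) by exists 0; rewrite near0.
have ub1 i : near i && (i <= t) -> i <= t by case/andP.
(* [tx] and [tz] are the last near index before [t] and the first one after it. *)
case: (ex_maxnP exP1 ub1) => tx /andP[nx txt] maxx.
have exP2 : exists i, near i && (t <= i) by exists n; rewrite nearn.
case: (ex_minnP exP2) => tz /andP[nz ttz] minz.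
have tzn : tz <= n by apply: minz; rewrite nearn.
have far i : tx < i < tz -> ~~ near i.
  move=> /andP[xi iz]; apply/negP => ni.
  have [it|/ltnW ti] := leqP i t.
    by have := maxx i; rewrite ni it => /(_ isT); lia.
  by have := minz i; rewrite ni ti => /(_ isT); lia.
move/asboolP: nx => [u1 Uu1 du1]; move/asboolP: nz => [u2 Uu2 du2].
have [lt|lt] := leqP (tz - tx) (2 * m + r).
  exists u1 => //; have := dT (p tx) (p t) u1; rewrite (dC (p t) (p tx)) hp ?txt//; lia.
have [q1 [l1 [gq1 Uq1]]] := hU _ Uu1; have [q2 [l2 [gq2 Uq2]]] := hU _ Uu2.
have gxz : path_geodesic (fun k => p (tx + k)) (tz - tx) (p tx) (p tz).
  by apply: path_geodesic_sub gp _; lia.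
(* If [p tx] is within [m] of [y], no point at distance [m] is available; the subsegment and the
   side from [u2] to [y] then bound a quadrilateral with short sides less than [m] and at most
   [N]. *)
have [xy|xy] := ltnP (d (p tx) y) m.
  have [|||t' t'l ht] := slim1 _ _ _ _ _ _ _ _ gxz (path_geodesic_rev gq2) _ _ (t - tx); try lia.
  exists (q2 (l2 - t')); first by apply: Uq2; lia.
  by move: ht; rewrite subnKC//; lia.
have [zy|zy] := ltnP (d (p tz) y) m.
  have [|||t' t'l ht] := slim1 _ _ _ _ _ _ _ _ gxz gq1 _ _ (t - tx); try lia.
  exists (q1 t'); first by apply: Uq1; lia.
  by move: ht; rewrite subnKC//; lia.
have [g1 gg1] := geo_ex (p tx) y; have [g2 gg2] := geo_ex (p tz) y.
have Lm : L0 <= m by lia.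
have [t1 t1l ht1] := corner_slim slim0 splitN Lm gg1 gq1 du1 xy.
have [t2 t2l ht2] := corner_slim slim0 splitN Lm gg2 gq2 du2 zy.
have e1 : d (p tx) (g1 m) = m by exact: path_geodesic_from gg1 xy.
have e1' : d (g1 m) y = d (p tx) y - m by exact: path_geodesic_to gg1 xy.
have e2 : d (p tz) (g2 m) = m by exact: path_geodesic_from gg2 zy.
have e2' : d (g2 m) y = d (p tz) y - m by exact: path_geodesic_to gg2 zy.
have dxz : d (p tx) (p tz) = tz - tx by rewrite hp//; lia.
have [||| i il cl] := Tm (p tx) y (p tz) (g1 m) (g2 m) _ _ e1 _ e2 _ _ gxz; try lia.
have di1 : d (p tx) (p (tx + i)) = i by rewrite hp; lia.
have di2 : d (p (tx + i)) (p tz) = tz - tx - i by rewrite hp; lia.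
(* Either alternative gives an index strictly between [tx] and [tz] that is near [U]. *)
case: cl => cl; exfalso.
  have := far (tx + i); have -> : near (tx + i).
    apply/asboolP; exists (q1 t1); first exact: Uq1.
    by have := dT (g1 m) (p (tx + i)) (q1 t1); rewrite /N; lia.
  have := dT (p (tx + i)) (p tx) (g1 m); have := dT (g1 m) (p tx) (p (tx + i)).
  by rewrite (dC (g1 m)) => ? ?; apply/implyP; lia.
have := far (tx + i); have -> : near (tx + i).
  apply/asboolP; exists (q2 t2); first exact: Uq2.
  by have := dT (g2 m) (p (tx + i)) (q2 t2); rewrite /N; lia.
have := dT (p (tx + i)) (p tz) (g2 m); have := dT (g2 m) (p tz) (p (tx + i)).
rewrite (dC (g2 m)) (dC (p tz) (p (tx + i))) => ? ?; apply/implyP; lia.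
Qed.
End Quad.

(** * Slim triangles of discrete geodesics *)

Definition slim_triangles (Delta : nat) : Prop :=
  forall x y z p n q l q' l',
    path_geodesic p n x z -> path_geodesic q l x y -> path_geodesic q' l' z y ->
    forall t, t <= n ->
    (exists2 i, i <= l & d (p t) (q i) <= Delta) \/
    (exists2 i, i <= l' & d (p t) (q' i) <= Delta).

Theorem cotlar_scale_slim r :
  (forall c, exists2 m, c <= m & cotlar_scale r m) ->
  exists Delta, slim_triangles Delta.
Proof.
move=> scales; have [Delta hD] := triangle_slim scales; exists Delta.
move=> x y z p n q l q' l' gp gq gq' t tn.
pose U u := (exists2 i, i <= l & u = q i) \/ (exists2 i, i <= l' & u = q' i).
have [||| u [[i il ->]|[i il ->]] du] := hD U x y z p n _ _ _ gp t tn.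
- have [_ qn _] := gq; have [_ q'n _] := gq'.
  move=> u [[i il ->]|[i il ->]].
    exists (fun k => q (i + k)), (l - i); rewrite -{1}qn; split.
      by apply: path_geodesic_sub gq _; rewrite il leqnn.
    by move=> k kl; left; exists (i + k) => //; lia.
  exists (fun k => q' (i + k)), (l' - i); rewrite -{1}q'n; split.
    by apply: path_geodesic_sub gq' _; rewrite il leqnn.
  by move=> k kl; right; exists (i + k) => //; lia.
- by left; exists 0 => //; case: gq.
- by right; exists 0 => //; case: gq'.
- by left; exists i.
- by right; exists i.
Qed.

(** Take the point of [p] as far from [x] as [w] is, or the end [y] if [p] is too short. Slimness
    puts it near a geodesic from [x] or [y] to [w], and comparing distances to the common end
    locates it near [w]. *)
Lemma almost_between Delta C x y w p n : slim_triangles Delta ->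
  path_geodesic p n x y -> d x w + d w y <= d x y + C ->
  exists2 i, i <= n & d w (p i) <= 2 * Delta + C.
Proof.
move=> slim gp hw; have dxy := path_geodesic_len gp.
have [q gq] := geo_ex x w; have [q' gq'] := geo_ex y w.
pose i := minn (d x w) n.
have il : i <= n by rewrite geq_minr.
have xi : d x (p i) = i by exact: path_geodesic_from gp il.
have iy : d (p i) y = n - i by exact: path_geodesic_to gp il.
exists i => //; case: (slim _ _ _ _ _ _ _ _ _ gp gq gq' i il) => [[j jl dj]|[j jl dj]].
  have e1 : d x (q j) = j by exact: path_geodesic_from gq jl.
  have e2 : d (q j) w = d x w - j by exact: path_geodesic_to gq jl.
  have := dT (q j) (p i) w; have := dT (q j) x (p i); have := dT (p i) x (q j).
  by rewrite (dC w (p i)) (dC (q j) (p i)); lia.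
have e1 : d y (q' j) = j by exact: path_geodesic_from gq' jl.
have e2 : d (q' j) w = d y w - j by exact: path_geodesic_to gq' jl.
have := dT (q' j) (p i) w; have := dT (p i) y (q' j); have := dT (q' j) y (p i).
by rewrite (dC w (p i)) (dC (q' j) (p i)) (dC y (p i)) (dC y w) in e2 *; lia.
Qed.
End DiscreteGeodesic.

(** * Word metric *)

Local Open Scope classical_set_scope.
Local Open Scope ring_scope.

Section WordMetric.
Variables (G : groupType) (S : set G).

Fixpoint walk (n : nat) (u v : G) : Prop :=
  if n is n'.+1 then exists2 w, cay_adj S u w & walk n' w v else u = v.

Lemma cay_adjC u v : cay_adj S u v -> cay_adj S v u.
Proof.
by case=> uv [s Ss h]; split; [exact/nesym | exists s => //; case: h; [right|left]].
Qed.

Lemma cay_adj_mull g u v : cay_adj S u v -> cay_adj S (g * u)%g (g * v)%g.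
Proof.
case=> uv [s Ss h]; split; first by move=> /mulgI.
by exists s => //; case: h => ->; rewrite mulgA; [left|right].
Qed.

Lemma walk_mull g n u v : walk n u v -> walk n (g * u)%g (g * v)%g.
Proof.
elim: n u => [u -> //|n IH u [w uw wv]].
by exists (g * w)%g; [exact: cay_adj_mull | exact: IH].
Qed.

Lemma walk_cat n m u v w : walk n u v -> walk m v w -> walk (n + m) u w.
Proof.
elim: n u => [u -> //|n IH u [x ux xv] vw].
by exists x => //; exact: IH.
Qed.

Lemma walkC n u v : walk n u v -> walk n v u.
Proof.
elim: n u => [u -> //|n IH u [x ux xv]]; rewrite -addn1.
by apply: walk_cat (IH _ xv) _; exists u => //; exact: cay_adjC.
Qed.

Hypothesis genS : generates S.

(** The elements reached from the identity form a subgroup containing [S]; translation gives the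
    other starting points. *)
Lemma walk_exists u v : exists n, `[< walk n u v >].
Proof.
pose H : {pred G} := fun g => `[< exists n, walk n 1%g g >].
suff : (u^-1 * v)%g \in H.
  move=> /asboolP[n h]; exists n; apply/asboolP.
  by have := walk_mull u h; rewrite mulg1 mulVKg.
apply: genS => [|s sS].
  split; first by apply/asboolP; exists 0%N.
  move=> x y /asboolP[n hn] /asboolP[m hm]; apply/asboolP; exists (n + m)%N.
  apply: walk_cat hn _; have /walkC := walk_mull (x / y)%g hm.
  by rewrite mulg1 mulgVK.
(* An identity element of [S] gives no edge and is reached by the empty walk. *)
apply/asboolP; have [->|s1] := eqVneq s 1%g; first by exists 0%N.
exists 1%N; exists s => //; split; first by apply/eqP; rewrite eq_sym.
by exists s; [rewrite inE in sS | left; rewrite mul1g].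
Qed.

Definition word_dist u v : nat := ex_minn (walk_exists u v).

Lemma word_dist_walk u v : walk (word_dist u v) u v.
Proof. by rewrite /word_dist; case: ex_minnP => n /asboolP. Qed.

Lemma word_dist_le n u v : walk n u v -> (word_dist u v <= n)%N.
Proof.
by move=> h; rewrite /word_dist; case: ex_minnP => m _; apply; apply/asboolP.
Qed.

Lemma word_dist_mull g u v : word_dist (g * u)%g (g * v)%g = word_dist u v.
Proof.
apply/eqP; rewrite eqn_leq !word_dist_le//; last exact/walk_mull/word_dist_walk.
have := walk_mull g^-1%g (word_dist_walk (g * u)%g (g * v)%g).
by rewrite !mulKg.
Qed.

Lemma word_dist_eq0 u v : word_dist u v = 0%N -> u = v.
Proof. by move=> e; have := word_dist_walk u v; rewrite e. Qed.

Lemma word_dist_adj u v : cay_adj S u v -> word_dist u v = 1%N.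
Proof.
move=> uv; apply/eqP; rewrite eqn_leq word_dist_le; last by exists v.
by rewrite lt0n; apply/eqP => /word_dist_eq0 e; case: uv.
Qed.

Lemma word_dist1_adj u v : word_dist u v = 1%N -> cay_adj S u v.
Proof. by move=> e; have := word_dist_walk u v; rewrite e => -[w uw <-]. Qed.

Lemma walk_fun n u v : walk n u v -> exists p : nat -> G,
  [/\ p 0%N = u, p n = v & forall i, (i < n)%N -> cay_adj S (p i) (p i.+1)].
Proof.
elim: n u => [u uv|n IH u [w uw /IH[p [p0 pn hp]]]]; first by exists (fun=> u).
exists (fun i => if i is j.+1 then p j else u); split => // -[|i]/= il.
  by rewrite p0.
exact: hp.
Qed.

Lemma word_dist_geodesic : geodesic_metric word_dist.
Proof.
have dC u v : word_dist u v = word_dist v u.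
  by apply/eqP; rewrite eqn_leq !word_dist_le//; exact/walkC/word_dist_walk.
have dT u v w : (word_dist u w <= word_dist u v + word_dist v w)%N.
  apply: word_dist_le; apply: walk_cat; exact: word_dist_walk.
have d0 u : word_dist u u = 0%N.
  by apply/eqP; rewrite -leqn0; exact: word_dist_le.
split=> // u v; have [p [p0 pn hp]] := walk_fun (word_dist_walk u v).
exists p; split=> // i j /andP[ij jn].
(* Upper bounds suffice: those for the three pieces of a shortest walk add up to its length, so each
   is an equality. *)
have up k l : (k + l <= word_dist u v)%N -> (word_dist (p k) (p (k + l)%N) <= l)%N.
  elim: l => [|l IH] kl; first by rewrite addn0 d0.
  apply: leq_trans (dT _ (p (k + l)%N) _) _; rewrite -[leqRHS]addn1 leq_add ?IH//.
    by lia.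
  by rewrite addnS word_dist_adj//; apply: hp; lia.
have := up i (j - i)%N; rewrite subnKC// => /(_ jn) h1.
have := up 0%N i; rewrite add0n p0 => /(_ (leq_trans ij jn)) h2.
have := up j (word_dist u v - j)%N; rewrite subnKC// pn => /(_ (leqnn _)) h3.
have := dT u (p i) v; have := dT (p i) (p j) v; lia.
Qed.

End WordMetric.

(** * Geometric realization *)

Section CayleyMetric.
Variables (R : realType) (G : groupType) (S : set G).
Hypothesis genS : generates S.
Implicit Types (x y z : cayley R S) (u v w : G).
Local Notation wd := (word_dist genS).

Lemma cayley_inj x y : bary x = bary y -> x = y.
Proof.
case: x y => [bx hx] [by_ hy] /= e; rewrite e in hx *.
by congr CayleyPoint; exact: Prop_irrelevance.
Qed.

Lemma on_edge_at0 u v : @on_edge_at R G u v 0 = on_edge_at u u 0.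
Proof. by apply/funext => w; rewrite /on_edge_at !mul0r. Qed.

Lemma on_edge_at1 u v : @on_edge_at R G u v 1 = on_edge_at v v 0.
Proof. by apply/funext => w; rewrite /on_edge_at subrr !mul0r subr0 mul1r add0r addr0. Qed.

Lemma on_edge_vertexl u v : cay_adj S u v -> on_edge u v (vertex R S u).
Proof. by move=> uv; split=> //; exists 0; rewrite ?lexx ?ler01// on_edge_at0. Qed.

Lemma on_edge_vertexr u v : cay_adj S u v -> on_edge u v (vertex R S v).
Proof. by move=> uv; split=> //; exists 1; rewrite ?lexx ?ler01// on_edge_at1. Qed.

Lemma bary_vertex u w : vertex R S u w = (w == u)%:R.
Proof. by rewrite /vertex /= /on_edge_at subr0 mul1r mul0r addr0. Qed.

Lemma bary_edge u v x t : cay_adj S u v -> bary x = on_edge_at u v t ->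
  x u = 1 - t.
Proof.
move=> [/eqP/negPf uv _] ->.
by rewrite /on_edge_at eqxx uv mulr0 addr0 mulr1.
Qed.

(** * The path metric *)

Lemma path_length_ge0 x y l : path_length x y l -> 0 <= l.
Proof. elim=> // *; exact: addr_ge0. Qed.

Lemma path_length_cat x y z l l' :
  path_length x y l -> path_length y z l' -> path_length x z (l + l').
Proof.
elim=> {x y l} [x|x y w u v l xu yu _ IH] h; first by rewrite add0r.
by rewrite -addrA; apply: PathStep xu yu (IH h).
Qed.

Lemma path_length_edge u v x y : on_edge u v x -> on_edge u v y ->
  path_length x y `|x u - y u|.
Proof.
by move=> xu yu; rewrite -[X in path_length _ _ X]addr0; apply: PathStep xu yu (PathNil _).
Qed.

Lemma path_lengthC x y l : path_length x y l -> path_length y x l.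
Proof.
elim=> {x y l} [x|x y w u v l xu yu _ IH]; first exact: PathNil.
rewrite addrC; apply: path_length_cat IH _; rewrite distrC.
exact: path_length_edge yu xu.
Qed.

Lemma path_length_walk n u v : walk S n u v ->
  path_length (vertex R S u) (vertex R S v) n%:R.
Proof.
elim: n u => [u ->|n IH u [w uw /IH h]]; first exact: PathNil.
rewrite -natr1 addrC; apply: path_length_cat h.
have := path_length_edge (on_edge_vertexl uw) (on_edge_vertexr uw).
case: (uw) => /eqP/negPf uw' _.
by rewrite !bary_vertex eqxx uw' subr0 normr1.
Qed.

Lemma path_length_to_vertex x : exists w, exists2 l, l <= 1 &
  path_length x (vertex R S w) l.
Proof.
have [u [v [t [uv t01 xE]]]] : exists u v t,
  [/\ u = v \/ cay_adj S u v, 0 <= t <= 1 & bary x = on_edge_at u v t] by case: x.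
case: uv => uv.
  exists u, 0 => //; have -> : x = vertex R S u; last exact: PathNil.
  apply: cayley_inj; rewrite xE -uv; apply/funext => w /=.
  by rewrite /on_edge_at; ring.
have xe : on_edge u v x by split=> //; exists t.
exists u, `|x u - vertex R S u u|; last first.
  exact: path_length_edge xe (on_edge_vertexl uv).
rewrite (bary_edge uv xE) bary_vertex eqxx addrAC subrr sub0r normrN.
by case/andP: t01 => t0 t1; rewrite ger0_norm.
Qed.

(** Makes the infimum in [dist] a genuine one; over an empty set it would be a default value. *)
Lemma path_length_exists x y : [set l | path_length x y l] !=set0.
Proof.
have [u [l _ xu]] := path_length_to_vertex x.
have [v [l' _ /path_lengthC yv]] := path_length_to_vertex y.
have uv := path_length_walk (word_dist_walk genS u v).
by exists (l + ((wd u v)%:R + l')); apply: path_length_cat xu (path_length_cat uv yv).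
Qed.

Lemma dist_le x y l : path_length x y l -> dist x y <= l.
Proof.
by move=> h; apply: ge_inf => //; exists 0 => {h} h /path_length_ge0.
Qed.

Lemma le_dist x y c : (forall l, path_length x y l -> c <= l) -> c <= dist x y.
Proof. by move=> h; apply: lb_le_inf => //; exact: path_length_exists. Qed.

Lemma dist_ge0 x y : 0 <= dist x y.
Proof. by apply: le_dist => l /path_length_ge0. Qed.

Lemma distxx x : dist x x = 0.
Proof. by apply/le_anti; rewrite dist_ge0 dist_le//; exact: PathNil. Qed.

Lemma distC x y : dist x y = dist y x.
Proof. by apply/le_anti/andP; split; apply: le_dist => l /path_lengthC /dist_le. Qed.

Lemma distT y x z : dist x z <= dist x y + dist y z.
Proof.
rewrite -lerBlDr; apply: le_dist => l xy; rewrite lerBlDr -lerBlDl.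
by apply: le_dist => l' yz; rewrite lerBlDl; apply: dist_le; exact: path_length_cat xy yz.
Qed.

Lemma dist_edge u v x y : on_edge u v x -> on_edge u v y ->
  dist x y <= `|x u - y u|.
Proof. by move=> xu yu; apply: dist_le; exact: path_length_edge xu yu. Qed.

Lemma near_vertex x : exists w, dist x (vertex R S w) <= 1.
Proof.
by have [w [l l1 /dist_le h]] := path_length_to_vertex x; exists w; exact: le_trans h l1.
Qed.

(* Extending the distance to a vertex affinely along the edges yields a
   1-Lipschitz function; hence no polygonal path beats the word distance. *)
Definition affine_extension (f : G -> R) x : R := \sum_(w \in setT) x w * f w.

Lemma affine_extension_edge f x u v t : bary x = on_edge_at u v t ->
  affine_extension f x = (1 - t) * f u + t * f v.
Proof.
move=> e; rewrite /affine_extension e /on_edge_at.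
have one (P : set G) a : P a -> \sum_(w \in P) ((w == a)%:R * f w) = f a.
  move=> Pa; rewrite -(fsbig_widen [set a])//=; first by rewrite fsbig_set1 eqxx mul1r.
    by move=> w ->.
  by move=> w /= [_ /eqP/negPf ->]; rewrite mul0r.
(* The coordinates vanish off [[set u; v]]; this also covers the degenerate case [u = v]. *)
rewrite -(fsbig_widen [set u; v])//=; last first.
  move=> w /= [_ /not_orP[/eqP/negPf -> /eqP/negPf ->]].
  by rewrite !mulr0 addr0 mul0r.
under eq_fsbigr do rewrite mulrDl -!mulrA.
rewrite fsbig_split//= -!mulr_fsumr !one//; [by right | by left].
Qed.

Lemma affine_extension_vertex f u : affine_extension f (vertex R S u) = f u.
Proof. by rewrite (@affine_extension_edge f _ u u 0)// mul0r subr0 mul1r addr0. Qed.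

Lemma affine_extension_lipschitz f x y l :
  (forall u v, cay_adj S u v -> `|f u - f v| <= 1) ->
  path_length x y l -> `|affine_extension f x - affine_extension f y| <= l.
Proof.
move=> lip; elim=> {x y l} [x|x y z u v l [uv [t _ xe]] [_ [t' _ ye]] _ IH].
  by rewrite subrr normr0.
rewrite -(subrKA (affine_extension f y)); apply: le_trans (ler_normD _ _) _.
rewrite lerD//.
rewrite (bary_edge uv xe) (bary_edge uv ye).
rewrite (affine_extension_edge f xe) (affine_extension_edge f ye).
have -> : (1 - t) * f u + t * f v - ((1 - t') * f u + t' * f v)
  = (1 - t - (1 - t')) * (f u - f v) by ring.
by rewrite normrM ler_piMr// lip.
Qed.

Lemma dist_vertex u v : dist (vertex R S u) (vertex R S v) = (wd u v)%:R.
Proof.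
apply/le_anti/andP; split.
  by apply: dist_le; apply: path_length_walk; exact: word_dist_walk.
have [d0 dC dT _] := word_dist_geodesic genS.
apply: le_dist => l /(@affine_extension_lipschitz (fun w => (wd u w)%:R)).
rewrite !affine_extension_vertex d0 sub0r normrN normr_nat; apply=> a b ab.
have h1 := dT u a b; have h2 := dT u b a.
rewrite (dC b a) (word_dist_adj genS ab) in h1 h2.
rewrite ler_norml; apply/andP; split.
  by rewrite lerBrDr addrC lerBlDr natr1 ler_nat -addn1.
by rewrite lerBlDr addrC natr1 ler_nat -addn1.
Qed.

(** * Geodesic segments *)

Section Geodesics.
Variables (x y : cayley R S) (gam : R -> cayley R S).
Hypothesis ggam : is_geodesic x y gam.

Lemma geodesic_dist_from t : 0 <= t <= dist x y -> dist x (gam t) = t.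
Proof.
case: ggam => <- _ h /[dup] t01 /andP[t0 _].
by rewrite h ?in_itv/= ?lexx ?dist_ge0// sub0r normrN ger0_norm.
Qed.

Lemma geodesic_dist_to t : 0 <= t <= dist x y -> dist (gam t) y = dist x y - t.
Proof.
case: ggam => _ e h /[dup] t01 /andP[t0 t1]; rewrite -{1}e.
by rewrite h ?in_itv/= ?lexx ?dist_ge0// distrC ger0_norm// subr_ge0.
Qed.

Lemma is_geodesic_rev : is_geodesic y x (fun t => gam (dist x y - t)).
Proof.
case: ggam => e0 e1 h; split; rewrite ?subr0// (distC y x) ?subrr// => s t.
rewrite !in_itv/= => /andP[s0 s1] /andP[t0 t1].
rewrite h ?in_itv/= ?subr_ge0 ?s1 ?t1 ?gerBl//.
by rewrite distrC; congr `|_|; ring.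
Qed.
End Geodesics.

Lemma geodesic_segmentC x y sigma :
  geodesic_segment x y sigma -> geodesic_segment y x sigma.
Proof.
case=> gam ggam ->; exists (fun t => gam (dist x y - t)); first exact: is_geodesic_rev.
rewrite (distC y x); apply/seteqP; split=> _ [t /= ht <-].
  move: ht; rewrite in_itv/= => /andP[t0 t1]; exists (dist x y - t); last by rewrite subKr.
  by rewrite /= in_itv/= subr_ge0 t1 gerBl.
move: ht; rewrite in_itv/= => /andP[t0 t1]; exists (dist x y - t) => //.
by rewrite /= in_itv/= subr_ge0 t1 gerBl.
Qed.

Lemma geodesic_segment_between x y sigma z : geodesic_segment x y sigma ->
  sigma z -> dist x z + dist z y = dist x y.
Proof.
case=> gam ggam -> [t /=]; rewrite in_itv/= => t01 <-.
by rewrite (geodesic_dist_from ggam)// (geodesic_dist_to ggam)// subrKC.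
Qed.

Lemma geodesic_segment_eq x y sigma z z' : geodesic_segment x y sigma ->
  sigma z -> sigma z' -> dist z z' = `|dist x z - dist x z'|.
Proof.
case=> gam ggam -> [t /=]; rewrite in_itv/= => t01 <- [t' /=]; rewrite in_itv/= => t01' <-.
by rewrite !(geodesic_dist_from ggam)//; case: ggam => _ _ ->; rewrite ?in_itv.
Qed.

Lemma geodesic_segment_refl x : geodesic_segment x x [set x].
Proof.
exists (fun=> x).
  split=> // s t; rewrite distxx !in_itv/= => /le_anti <- /le_anti <-.
  by rewrite subrr normr0.
apply/seteqP; split=> [_ /= ->|_ [t _ <-]//].
by exists 0; rewrite //= in_itv/= distxx lexx.
Qed.

(* [u] and [v] need not be adjacent when [t = 0]: a path is evaluated there at
   its last vertex, whose successor [v] is arbitrary. *)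
Definition edge_point u v t : cayley R S :=
  if pselect (exists a b t', [/\ a = b \/ cay_adj S a b, 0 <= t' <= 1
                      & on_edge_at u v t = on_edge_at a b t'])
  is left h then CayleyPoint h else vertex R S u.

Lemma edge_point0 u v : edge_point u v 0 = vertex R S u.
Proof.
rewrite /edge_point; case: pselect => // h; apply: cayley_inj => /=.
exact: on_edge_at0.
Qed.

Lemma edge_pointE u v t : cay_adj S u v -> 0 <= t <= 1 ->
  bary (edge_point u v t) = on_edge_at u v t.
Proof.
move=> uv t01; rewrite /edge_point; case: pselect => // -[].
by exists u, v, t; split=> //; right.
Qed.

Lemma dist_edge_point u v s t : cay_adj S u v -> 0 <= s <= 1 -> 0 <= t <= 1 ->
  dist (edge_point u v s) (edge_point u v t) <= `|s - t|.
Proof.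
move=> uv s01 t01.
have -> : `|s - t| = `|edge_point u v s u - edge_point u v t u|.
  rewrite !(bary_edge uv (edge_pointE uv _))//.
  by rewrite distrC; congr `|_|; ring.
by apply: (@dist_edge u v); split=> //; [exists s|exists t]; rewrite ?edge_pointE.
Qed.

Lemma edge_point1 u v : cay_adj S u v -> edge_point u v 1 = vertex R S v.
Proof.
move=> uv; apply: cayley_inj; rewrite edge_pointE ?ler01 ?lexx//.
exact: on_edge_at1.
Qed.

(** * Realization of discrete geodesics *)

Definition path_realization (p : nat -> G) (t : R) : cayley R S :=
  edge_point (p (Num.truncn t)) (p (Num.truncn t).+1) (t - (Num.truncn t)%:R).

Lemma path_realization_nat p i : path_realization p i%:R = vertex R S (p i).
Proof. by rewrite /path_realization natrK subrr edge_point0. Qed.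

Section PathRealization.
Variables (p : nat -> G) (n : nat) (u v : G).
Hypothesis gp : path_geodesic wd p n u v.
Let adj i : (i < n)%N -> cay_adj S (p i) (p i.+1).
Proof.
move=> il; apply: (word_dist1_adj (genS := genS)); case: gp => _ _ ->.
  by rewrite subSnn.
by rewrite leqnSn.
Qed.

Lemma path_realization_near t : 0 <= t <= n%:R ->
  dist (vertex R S (p (Num.truncn t))) (path_realization p t) <= t - (Num.truncn t)%:R.
Proof.
move=> /andP[t0 tn]; have /andP[t1 t2] := truncn_itv t0.
rewrite /path_realization -(edge_point0 _ (p (Num.truncn t).+1)).
have [il|il] := ltnP (Num.truncn t) n.
  apply: le_trans (dist_edge_point (adj il) _ _) _.
  - by rewrite lexx ler01.
  - by rewrite subr_ge0 t1 lerBlDl natr1 ltW.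
  - by rewrite sub0r normrN ger0_norm// subr_ge0.
(* Only [t = n] is left, where no edge of the path starts. *)
have -> : t - (Num.truncn t)%:R = 0.
  by apply/le_anti; rewrite subr_ge0 t1 subr_le0 (le_trans tn)// ler_nat.
by rewrite distxx.
Qed.

Lemma path_realization_lipschitz s t : 0 <= s -> s <= t -> t <= n%:R ->
  dist (path_realization p s) (path_realization p t) <= t - s.
Proof.
move=> s0 st tn; have t0 := le_trans s0 st; have sn := le_trans st tn.
have /andP[s1 s2] := truncn_itv s0; have /andP[t1 t2] := truncn_itv t0.
have lein : (Num.truncn s <= Num.truncn t)%N by rewrite le_truncn.
have jn : (Num.truncn t <= n)%N by rewrite -(ler_nat R) (le_trans t1).
have nt : dist (vertex R S (p (Num.truncn t))) (path_realization p t) <= t - (Num.truncn t)%:R.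
  by apply: path_realization_near; rewrite t0.
move: lein; rewrite leq_eqVlt => /orP[/eqP e|lt].
  have [il|il] := ltnP (Num.truncn s) n.
    rewrite /path_realization -e; apply: le_trans (dist_edge_point (adj il) _ _) _.
    - by rewrite subr_ge0 s1 lerBlDl natr1 ltW.
    - by rewrite subr_ge0 {1}e t1 lerBlDl natr1 e ltW.
    - by rewrite distrC ger0_norm; lra.
  have te : t = s.
    by apply/le_anti; rewrite st andbT (le_trans tn)// (le_trans _ s1)// ler_nat.
  by rewrite te distxx subrr.
(* On different edges, pass through the vertex that ends the edge of [s] and the vertex that starts
   the edge of [t]. *)
have h1 : dist (path_realization p s) (vertex R S (p (Num.truncn s).+1))
    <= (Num.truncn s).+1%:R - s.
  have il := leq_trans lt jn.
  rewrite /path_realization -(edge_point1 (adj il)).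
  apply: le_trans (dist_edge_point (adj il) _ _) _.
  - by rewrite subr_ge0 s1 lerBlDl natr1 ltW.
  - by rewrite lexx ler01.
  - by rewrite -natr1 distrC ger0_norm; [lra | rewrite -natr1 in s2; lra].
have h2 : dist (vertex R S (p (Num.truncn s).+1)) (vertex R S (p (Num.truncn t)))
   = (Num.truncn t)%:R - (Num.truncn s).+1%:R.
  by rewrite dist_vertex; case: gp => _ _ ->; rewrite ?lt//= natrB.
have := distT (vertex R S (p (Num.truncn s).+1)) (path_realization p s) (path_realization p t).
have := distT (vertex R S (p (Num.truncn t))) (vertex R S (p (Num.truncn s).+1))
  (path_realization p t).
rewrite h2; lra.
Qed.

Lemma is_geodesic_path_realization :
  is_geodesic (vertex R S u) (vertex R S v) (path_realization p).
Proof.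
have duv : dist (vertex R S u) (vertex R S v) = n%:R.
  by rewrite dist_vertex (path_geodesic_len gp).
have e0 : path_realization p 0 = vertex R S u.
  by rewrite (path_realization_nat p 0); case: gp => ->.
have e1 : path_realization p n%:R = vertex R S v.
  by rewrite path_realization_nat; case: gp => _ ->.
split; rewrite ?duv//.
(* A 1-Lipschitz path of duration [n] between points at distance [n] has no slack on any
   subinterval. *)
have main s t : 0 <= s -> s <= t -> t <= n%:R ->
  dist (path_realization p s) (path_realization p t) = t - s.
  move=> s0 st tn; apply/le_anti; rewrite path_realization_lipschitz//=.
  have := path_realization_lipschitz (lexx 0) s0 (le_trans st tn).
  have := path_realization_lipschitz (le_trans s0 st) tn (lexx _).
  have := distT (path_realization p s) (vertex R S u) (vertex R S v).
  have := distT (path_realization p t) (path_realization p s) (vertex R S v).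
  rewrite duv e0 e1; lra.
move=> s t; rewrite !in_itv/= => /andP[s0 sn] /andP[t0 tn].
have [st|ts] := leP s t.
  by rewrite main// distrC ger0_norm// subr_ge0.
by rewrite distC main ?(ltW ts)// ger0_norm// subr_ge0 ltW.
Qed.

Definition path_segment : set (cayley R S) :=
  path_realization p @` `[0, dist (vertex R S u) (vertex R S v)].

Lemma path_segmentP : geodesic_segment (vertex R S u) (vertex R S v) path_segment.
Proof. by exists (path_realization p) => //; exact: is_geodesic_path_realization. Qed.

Lemma path_segment_vertex i : (i <= n)%N -> path_segment (vertex R S (p i)).
Proof.
move=> il; exists i%:R; last exact: path_realization_nat.
by rewrite /= in_itv/= dist_vertex (path_geodesic_len gp) ler0n ler_nat.
Qed.

Lemma path_segment_near x : path_segment x ->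
  exists2 i, (i <= n)%N & dist x (vertex R S (p i)) <= 1.
Proof.
case=> t /=; rewrite in_itv/= dist_vertex (path_geodesic_len gp) => t0n <-.
have /andP[t0 tn] := t0n; have /andP[t1 t2] := truncn_itv t0.
exists (Num.truncn t); first by rewrite -(ler_nat R) (le_trans t1).
rewrite distC; apply: le_trans (path_realization_near t0n) _.
by rewrite -natr1 in t2; lra.
Qed.
End PathRealization.

(** * From slim discrete triangles to hyperbolicity *)

Lemma path_geodesic_exists u v : exists p, path_geodesic wd p (wd u v) u v.
Proof. by case: (word_dist_geodesic genS). Qed.

Lemma geodesic_segment_exists u v :
  exists sigma, geodesic_segment (vertex R S u) (vertex R S v) sigma.
Proof.
by have [p gp] := path_geodesic_exists u v; exists (path_segment p u v); exact: path_segmentP gp.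
Qed.

Lemma geodesic_near_path (Delta : nat) u v p n x y sigma z :
  slim_triangles wd Delta -> path_geodesic wd p n u v ->
  geodesic_segment x y sigma ->
  dist x (vertex R S u) <= 1 -> dist y (vertex R S v) <= 1 -> sigma z ->
  exists2 i, (i <= n)%N & dist z (vertex R S (p i)) <= (2 * Delta + 7)%:R.
Proof.
move=> slim gp gs xu yv sz; have [w zw] := near_vertex z.
have bet := geodesic_segment_between gs sz.
(* The slack 6: replacing each of [x], [y] and [z] by a vertex within distance 1 costs 2. *)
have [|i il h] := @almost_between _ _ (word_dist_geodesic genS) Delta 6 u v w p n slim gp.
  rewrite -(ler_nat R) !natrD -!dist_vertex.
  have := distT x (vertex R S u) (vertex R S w); have := distT z x (vertex R S w).
  have := distT y (vertex R S w) (vertex R S v); have := distT z (vertex R S w) y.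
  have := distT (vertex R S u) x y; have := distT (vertex R S v) (vertex R S u) y.
  rewrite (distC (vertex R S u) x) (distC (vertex R S w) z) (distC (vertex R S v) y); lra.
exists i => //; apply: le_trans (distT (vertex R S w) _ _) _.
rewrite dist_vertex addrC; have -> : (2 * Delta + 7 = 2 * Delta + 6 + 1)%N by lia.
by rewrite natrD lerD// ler_nat.
Qed.

(** The point of the geodesic with parameter [i], cut off at its end, is close to some [p j];
    comparing distances to [u] and [x] then forces [j] close to [i]. *)
Lemma path_near_geodesic (Delta : nat) u v p n x y sigma i :
  slim_triangles wd Delta -> path_geodesic wd p n u v ->
  geodesic_segment x y sigma ->
  dist x (vertex R S u) <= 1 -> dist y (vertex R S v) <= 1 -> (i <= n)%N ->
  exists2 z, sigma z & dist z (vertex R S (p i)) <= (4 * Delta + 18)%:R.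
Proof.
move=> slim gp gs xu yv il; have [gam ggam sE] := gs.
have := distT x (vertex R S u) (vertex R S v); have := distT y x (vertex R S v).
rewrite dist_vertex (path_geodesic_len gp) (distC (vertex R S u) x) => d1 d2.
pose t := Num.min i%:R (dist x y).
have iln : i%:R <= n%:R :> R by rewrite ler_nat.
have t01 : 0 <= t <= dist x y by rewrite /t le_min ler0n dist_ge0 ge_min lexx orbT.
have ti : `|t - i%:R| <= 2.
  by rewrite ler_norml /t; case: (leP (i%:R : R) (dist x y)) => h; apply/andP; split; lra.
have st : sigma (gam t) by rewrite sE; exists t => //; rewrite /= in_itv.
exists (gam t) => //.
have [j jl hj] := geodesic_near_path slim gp gs xu yv st.
have xt := geodesic_dist_from ggam t01.
have uj : dist (vertex R S u) (vertex R S (p j)) = j%:R.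
  by rewrite dist_vertex (path_geodesic_from gp jl).
have ij : dist (vertex R S (p j)) (vertex R S (p i)) = `|i%:R - j%:R|.
  rewrite dist_vertex; have [_ _ hp] := gp.
  case: (leqP i j) => ij.
    have [_ dC _ _] := word_dist_geodesic genS.
    by rewrite dC hp ?ij// natrB// distrC ger0_norm// subr_ge0 ler_nat.
  by rewrite hp ?(ltnW ij)// natrB ?(ltnW ij)// ger0_norm// subr_ge0 ler_nat ltnW.
have := distT (vertex R S (p j)) (gam t) (vertex R S (p i)); rewrite ij.
have := distT (vertex R S u) x (vertex R S (p j)); rewrite uj.
have := distT (gam t) x (vertex R S (p j)).
have := distT x (vertex R S u) (vertex R S (p j)); rewrite uj xt (distC (vertex R S u) x).
have := distT (vertex R S (p j)) x (gam t); rewrite xt (distC (vertex R S (p j)) (gam t)).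
move: hj ti; rewrite !(natrD, natrM) !ler_norml => hj /andP[t1 t2] h1 h2 h3 h4.
have : `|i%:R - j%:R| <= 2 * Delta%:R + 10 :> R.
  by rewrite ler_norml; apply/andP; split; lra.
lra.
Qed.

Theorem slim_triangles_hyperbolic Delta :
  slim_triangles wd Delta -> hyperbolic R S.
Proof.
(* The sum of [2 * Delta + 7] to a discrete side, [Delta] across the discrete triangle and
   [4 * Delta + 18] back, plus 1 for strictness. *)
move=> slim; exists ((7 * Delta + 26)%:R).
have main x y z s1 s2 s3 : geodesic_segment x z s1 -> geodesic_segment x y s2 ->
    geodesic_segment z y s3 -> s1 `<=` nbhd ((7 * Delta + 26)%:R) (s2 `|` s3).
  move=> g1 g2 g3 w sw; have [x' hx] := near_vertex x; have [y' hy] := near_vertex y.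
  have [z' hz] := near_vertex z.
  have [p1 gp1] := path_geodesic_exists x' z'; have [p2 gp2] := path_geodesic_exists x' y'.
  have [p3 gp3] := path_geodesic_exists z' y'.
  have [i il hi] := geodesic_near_path slim gp1 g1 hx hz sw.
  have [[j jl hj]|[j jl hj]] := slim _ _ _ _ _ _ _ _ _ gp1 gp2 gp3 i il.
    have [q sq hq] := path_near_geodesic slim gp2 g2 hx hy jl.
    exists q; first by left.
    have := distT (vertex R S (p1 i)) w q; have := distT (vertex R S (p2 j)) (vertex R S (p1 i)) q.
    rewrite dist_vertex (distC (vertex R S (p2 j)) q);
    move: hj hi hq; rewrite -(ler_nat R) !(natrD, natrM); lra.
  have [q sq hq] := path_near_geodesic slim gp3 g3 hz hy jl.
  exists q; first by right.
  have := distT (vertex R S (p1 i)) w q; have := distT (vertex R S (p3 j)) (vertex R S (p1 i)) q.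
  rewrite dist_vertex (distC (vertex R S (p3 j)) q);
    move: hj hi hq; rewrite -(ler_nat R) !(natrD, natrM); lra.
move=> x y z s1 s2 s3 g1 g2 g3; have g1' := geodesic_segmentC g1.
have g2' := geodesic_segmentC g2; have g3' := geodesic_segmentC g3.
split.
- by rewrite setUC; exact: main g1 g3' g2.
- by rewrite setUC; exact: main g2 g1' g3.
- by rewrite setUC; exact: main g3 g2' g1.
Qed.
End CayleyMetric.

(** * The Cotlar identity *)

Section Multipliers.
Variables (R : realType) (G : groupType).
Local Notation C := (R[i])%C.
Local Notation lam := (@lambda R G).
Variables (I : finType) (L : I -> set G) (eps : I -> C).

Definition symbol (g : G) : C := \sum_i eps i * (g \in L i)%:R.

Lemma hilbert_transform_lambda c g :
  hilbert_transform L eps (c *: lam g) = (c * symbol g) *: lam g.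
Proof.
rewrite /hilbert_transform /symbol mulr_sumr scaler_suml; apply: eq_bigr => i _.
rewrite fourier_proj_lambda; case: ifP => _; rewrite ?mulr1 ?mulr0 ?scale0r ?scaler0//.
by rewrite scalerA mulrC.
Qed.

Lemma hilbert_transform_circ_lambda c g :
  hilbert_transform_circ L eps (c *: lam g) = (c * (symbol g^-1%g)^*) *: lam g.
Proof.
rewrite /hilbert_transform_circ /symbol rmorph_sum mulr_sumr scaler_suml.
apply: eq_bigr => i _; rewrite fourier_proj_lambda rmorphM rmorph_nat.
have -> : (g \in [set (h^-1)%g | h in L i]) = ((g^-1)%g \in L i).
  apply/idP/idP; rewrite !inE; first by case=> h Lh <-; rewrite invgK.
  by move=> h; exists g^-1%g => //; rewrite invgK.
case: ifP => _; rewrite ?mulr1 ?mulr0 ?scale0r ?scaler0//.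
by rewrite scalerA mulrC.
Qed.

Lemma lambdaZ_comp (a b : C) g h :
  (a *: lam g) \o (b *: lam h) = (a * b) *: lam (g * h)%g.
Proof.
rewrite -lambdaM -scalerA; apply/funext => xi; apply/val_inj/funext => x /=.
by [].
Qed.

Lemma lambda_inj (a b : C) g : a *: lam g = b *: lam g -> a = b.
Proof.
by move=> /(congr1 (fun T => fourier_coef T g)); rewrite !fourier_coef_lambda eqxx !mulr1.
Qed.

Lemma symbol_disjoint i g : trivIset setT L -> L i g -> symbol g = eps i.
Proof.
move=> tL Lg; rewrite /symbol (bigD1 i)//= mem_set// mulr1 big1 ?addr0// => j ji.
rewrite memNset ?mulr0// => Ljg; move/eqP: ji; apply.
by apply: tL => //; exists g.
Qed.
Lemma symbol_notin g : (forall i, ~ L i g) -> symbol g = 0.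
Proof. by move=> Lg; rewrite /symbol big1// => i _; rewrite memNset ?mulr0. Qed.
End Multipliers.

Section CotlarSymbol.
Variables (R : realType) (G : groupType).
Local Notation C := (R[i])%C.
Local Notation lam := (@lambda R G).

(** Every term is a multiple of the single operator [lam (g * h^-1)], so only its coefficient has to
    be compared. *)
Lemma cotlar_identity_symbol (I : finType) (L M : I -> set G) (eps : I -> C) g h :
  hilbert_transform L eps (lam g) \o hilbert_transform_circ L eps (lam h^-1%g) =
    hilbert_transform M eps (lam g \o hilbert_transform_circ M eps (lam h^-1%g))
    + hilbert_transform_circ M eps (hilbert_transform M eps (lam g) \o lam h^-1%g)
    - hilbert_transform_circ M eps (hilbert_transform M eps (lam g \o lam h^-1%g))
  <-> symbol L eps g * (symbol L eps h)^* =
    symbol M eps (g * h^-1)%g * (symbol M eps h)^*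
    + symbol M eps g * (symbol M eps (h * g^-1)%g)^*
    - symbol M eps (g * h^-1)%g * (symbol M eps (h * g^-1)%g)^*.
Proof.
have l1 k : lam k = 1 *: lam k by rewrite scale1r.
rewrite lambdaM (l1 g) (l1 h^-1%g) (l1 (g / h)%g).
rewrite !(hilbert_transform_lambda, hilbert_transform_circ_lambda, lambdaZ_comp).
rewrite !mul1r invgK invgM invgK -scalerDl -scalerBl.
rewrite (mulrC (_ h)^* (symbol M eps _)).
by rewrite !mulr1; split=> [/lambda_inj|->].
Qed.
End CotlarSymbol.

(** * Branches, and the Cotlar property of hyperbolic graphs *)

Section Branches.
Variables (R : realType) (G : groupType) (S : set G).
Hypothesis genS : generates S.
Local Notation C := (R[i])%C.
Local Notation wd := (word_dist genS).
Local Notation vtx := (vertex R S).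

Lemma geodesic_segment_ends (x y : cayley R S) sigma :
  geodesic_segment x y sigma -> sigma x /\ sigma y.
Proof.
case=> gam [e0 e1 _] ->; split; [exists 0 | exists (dist x y)] => //;
by rewrite /= in_itv/= (dist_ge0 genS)// lexx.
Qed.

(** Two geodesics from the identity to [g] form a triangle whose third side is the constant one at
    [g]. *)
Lemma hyperbolic_branch_ex (delta rho : R) (A : set (cayley R S)) :
  delta_hyperbolic S delta -> delta <= rho -> 0 < rho ->
  branch_ex A `<=` branch_all rho A.
Proof.
move=> hyp dr r0 g [sigma gs [a [sa Aa]]]; exists a => // tau gt.
have [] := hyp _ _ _ _ _ _ gs (geodesic_segment_refl genS (vtx g)) (geodesic_segmentC genS gt).
move=> /(_ a sa)[q tq aq] _ _; exists q; split.
  by case: tq => [->|//]; have [] := geodesic_segment_ends gt.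
by rewrite /gball gt_eqF//= (distC genS); exact: lt_le_trans aq dr.
Qed.

(** The inequality says that the Gromov product of [g] and [k] at the identity is at least
    [m + rho]. This keeps the side from [g] to [k] too far from the identity to pass near [a], so
    thinness sends [a] to the side from the identity to [k]. *)
Lemma hyperbolic_branch_product (delta rho : R) (m : nat) (A : set (cayley R S)) g k :
  delta_hyperbolic S delta -> delta <= rho -> 0 < rho -> A `<=` sphere m ->
  2 * m%:R + 2 * rho + dist (vtx g) (vtx k) <= len R S g + len R S k ->
  branch_ex A g -> branch_all rho A k.
Proof.
move=> hyp dr r0 Am ineq [sigma gs [a [sa Aa]]]; exists a => // tau gt.
have [nu gn] := geodesic_segment_exists R genS g k.
have [] := hyp _ _ _ _ _ _ gs gn (geodesic_segmentC genS gt).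
move=> /(_ a sa)[q [nq|tq] aq] _ _; last first.
  by exists q; split=> //; rewrite /gball gt_eqF//= (distC genS); exact: lt_le_trans aq dr.
exfalso; have ma : dist a (vtx 1%g) = m%:R := Am _ Aa.
have bet := geodesic_segment_between genS gn nq.
have h1 := distT genS a (vtx 1%g) q; rewrite (distC genS (vtx 1%g) a) in h1.
have h2 := distT genS q (vtx 1%g) (vtx g).
have h3 := distT genS q (vtx 1%g) (vtx k).
move: ineq; rewrite /len (distC genS (vtx g) q) in bet *; lra.
Qed.

Lemma len_word_dist g : len R S g = (wd 1%g g)%:R.
Proof. exact: dist_vertex. Qed.

Lemma hyperbolic_cotlar (delta rho : R) (m : nat) :
  delta_hyperbolic S delta -> delta <= rho -> 0 < rho -> cotlar_property S rho m.
Proof.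
move=> hyp dr r0 I A eps Am tA _ /= g h [i _ gi] [j _ hj] long.
have ea k := hyperbolic_branch_ex (A := A k) hyp dr r0.
have tE : trivIset setT (fun i => branch_ex (A i)).
  move=> k l _ _ [x [kx lx]]; apply: tA => //.
  by exists x; split; [exact: ea | exact: ea].
apply/cotlar_identity_symbol.
rewrite (symbol_disjoint eps tE gi) (symbol_disjoint eps tE hj).
rewrite (symbol_disjoint eps tA (ea _ _ gi)) (symbol_disjoint eps tA (ea _ _ hj)).
have [_ dC _ _] := word_dist_geodesic genS.
have gk : wd g (g * h^-1)%g = wd 1%g h.
  by rewrite -{1}[g]mulg1 word_dist_mull -(word_dist_mull genS h) mulg1 mulgV dC.
have hk : wd h (h * g^-1)%g = wd 1%g g.
  by rewrite -{1}[h]mulg1 word_dist_mull -(word_dist_mull genS g) mulg1 mulgV dC.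
have kk : wd 1%g (h * g^-1)%g = wd 1%g (g * h^-1)%g.
  rewrite -(word_dist_mull genS (g * h^-1)%g) mulg1 dC; congr (wd _ _).
  by rewrite mulgA mulgVK mulgV.
move: long; rewrite len_word_dist => long.
(* The longer of [g] and [h] decides which case holds. *)
have [c1|c2] : 2 * m%:R + 2 * rho + (wd 1%g h)%:R <= (wd 1%g g)%:R + (wd 1%g (g * h^-1)%g)%:R
  \/ 2 * m%:R + 2 * rho + (wd 1%g g)%:R <= (wd 1%g h)%:R + (wd 1%g (g * h^-1)%g)%:R :> R.
- have [le|/ltW le] := leP ((wd 1%g h)%:R : R) (wd 1%g g)%:R; [left|right]; lra.
- have ki : branch_all rho (A i) (g * h^-1)%g.
    apply: (@hyperbolic_branch_product delta rho m (A i) g) => //.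
    by rewrite !len_word_dist (dist_vertex R genS) gk.
  (* Both [g] and [g * h^-1] now have symbol [eps i], so the terms in the unknown symbol of
     [h * g^-1] cancel. *)
  by rewrite (symbol_disjoint eps tA ki); ring.
- have kj : branch_all rho (A j) (h * g^-1)%g.
    apply: (@hyperbolic_branch_product delta rho m (A j) h) => //.
    by rewrite !len_word_dist (dist_vertex R genS) hk kk.
  by rewrite (symbol_disjoint eps tA kj); ring.
Qed.

Lemma branch_ex_between (A : set (cayley R S)) a g :
  A (vtx a) -> (wd 1%g a + wd a g = wd 1%g g)%N -> branch_ex A g.
Proof.
move=> Aa bet; have gm := word_dist_geodesic genS.
have [p gp] := path_geodesic_exists genS 1%g a.
have [q gq] := path_geodesic_exists genS a g.
have gc := path_geodesic_cat gm gp gq (esym bet).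
exists (path_segment (fun i => if (i <= wd 1%g a)%N then p i else q (i - wd 1%g a)%N) 1%g g).
  exact: path_segmentP gc.
exists (vtx a); split=> //.
have [_ pa _] := gp.
have := path_segment_vertex R gc (leq_addr (wd a g) (wd 1%g a)).
by rewrite leqnn pa.
Qed.

Lemma branch_all_near rho (A : set (cayley R S)) k p n :
  0 < rho -> branch_all rho A k -> path_geodesic wd p n 1%g k ->
  exists2 c, A c & exists2 i, (i <= n)%N & dist (vtx (p i)) c <= rho + 1.
Proof.
move=> r0 [c Ac h] gp; exists c => //.
have [q [sq]] := h _ (path_segmentP R gp).
rewrite /gball gt_eqF//= => qc; have [i il hi] := path_segment_near gp sq.
exists i => //; have := distT genS q (vtx (p i)) c.
by rewrite (distC genS (vtx (p i)) q); lra.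
Qed.

(** A geodesic to a common element has points within [rho] of [a] and of [b]. Their distances to the
    identity differ from [m] by less than [rho], so they are within [2 * rho] of each other along
    the geodesic, and [a] and [b] are less than [4 * rho] apart. *)
Lemma branch_all_disjoint rho m (a b : cayley R S) : 0 < rho ->
  sphere m a -> sphere m b -> 4 * rho <= dist a b ->
  branch_all rho [set a] `&` branch_all rho [set b] = set0.
Proof.
move=> r0 am bm ab; rewrite -subset0 => k [[_ -> ka] [_ -> kb]].
have [tau gt] := geodesic_segment_exists R genS 1%g k.
have [q [tq qa]] := ka _ gt; have [q' [tq' qb]] := kb _ gt.
move: qa qb; rewrite /gball gt_eqF//= => qa qb.
have := geodesic_segment_eq genS gt tq tq'.
have h1 := distT genS a (vtx 1%g) q; have h2 := distT genS q (vtx 1%g) a.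
have h3 := distT genS b (vtx 1%g) q'; have h4 := distT genS q' (vtx 1%g) b.
have h5 := distT genS q a b; have h6 := distT genS q' q b.
rewrite /sphere /= in am bm.
rewrite (distC genS (vtx 1%g) a) (distC genS (vtx 1%g) b) am bm in h1 h2 h3 h4.
rewrite (distC genS a q) in h1 h5; rewrite (distC genS b q') in h3 * => e.
have : `|dist (vtx 1%g) q - dist (vtx 1%g) q'| < 2 * rho.
  by rewrite ltr_norml; apply/andP; split; lra.
rewrite -e; lra.
Qed.

End Branches.

(** Summing the identities, weighted by [e], over the fourth roots of unity isolates the coefficient
    of [e'], the inverse of [e]. It is 1 on the left and 0 on the right, where [e'] occurs only
    multiplied by [e]. *)
Lemma cotlar_polarization (K : comNzRingType) (i al be k2 et1 et2 ga1 ga2 k1 : K) :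
  i * i = -1 ->
  (forall e e' : K, (e, e') \in [:: (1, 1); (-1, -1); (i, - i); (- i, i)] ->
    (1 + e * be) * (al + e') =
    e * k2 * (et1 + e' * et2) + (ga1 + e * ga2) * k1 - e * k2 * k1) ->
  4%:R = 0 :> K.
Proof.
move=> ii E.
have := E _ _ (_ : (1, 1) \in _); have := E _ _ (_ : (-1, -1) \in _).
have := E _ _ (_ : (i, -i) \in _); have := E _ _ (_ : (-i, i) \in _).
rewrite !inE !eqxx ?orbT => /(_ isT) E4 /(_ isT) E3 /(_ isT) E2 /(_ isT) E1.
(* The multiple of [i * i + 1] makes this an identity of polynomials, valid before [i * i = -1] is
   used. *)
have -> : 4%:R = (1 + 1 * be) * (al + 1) - (1 + -1 * be) * (al - 1)
  + i * ((1 + i * be) * (al - i) - (1 + - i * be) * (al + i))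
  - 2%:R * (al * be - 1) * (i * i + 1) by ring.
rewrite E1 E2 E3 E4 ii addNr mulr0 subr0.
have -> : forall x y z w : K, x - y + i * (z - w) = x - y + i * z - i * w.
  by move=> *; ring.
transitivity (2%:R * (k2 * et1 + ga2 * k1 - k2 * k1) * (i * i + 1)); first by ring.
by rewrite ii addNr mulr0.
Qed.

(** * From the Cotlar property to the scale condition *)

Section Converse.
Variables (R : realType) (G : groupType) (S : set G).
Hypothesis genS : generates S.
Local Notation C := (R[i])%C.
Local Notation wd := (word_dist genS).
Local Notation vtx := (vertex R S).

Lemma cotlar_property_symbol (rho : R) (m : nat) : cotlar_property S rho m ->
  forall (I : finType) (A : I -> set (cayley R S)) (eps : I -> C),
    (forall i, A i `<=` sphere m) ->
    trivIset setT (fun i => branch_all rho (A i)) ->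
    (forall i, `|eps i| <= 1) ->
  let cex := symbol (fun i => branch_ex (A i)) eps in
  let call := symbol (fun i => branch_all rho (A i)) eps in
  forall g h i j, branch_ex (A i) g -> branch_ex (A j) h ->
    2 * m%:R + 2 * rho <= len R S (g * h^-1)%g ->
  cex g * (cex h)^* = call (g * h^-1)%g * (call h)^*
    + call g * (call (h * g^-1)%g)^* - call (g * h^-1)%g * (call (h * g^-1)%g)^*.
Proof.
move=> cot I A eps Am tA eps1 /= g h i j gi hj long.
by apply/cotlar_identity_symbol; apply: cot => //; [exists i | exists j].
Qed.

(* For distant [a] and [b] the branches of [{a}] and [{b}] are disjoint, and the
   coefficient of [eps_a * eps_b^*] in the Cotlar identity gives the claim; for
   close ones it follows from the single set [{a, b}]. *)
Lemma cotlar_property_branch (rho : R) (m : nat) (a b : cayley R S) g h :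
  0 < rho -> cotlar_property S rho m -> sphere m a -> sphere m b ->
  branch_ex [set a] g -> branch_ex [set b] h ->
  2 * m%:R + 2 * rho <= len R S (g * h^-1)%g ->
  exists A B : set (cayley R S),
    [/\ forall c, A c -> dist c a <= 4 * rho,
        forall c, B c -> dist c b <= 4 * rho
      & branch_all rho A (g * h^-1)%g \/ branch_all rho B (h * g^-1)%g].
Proof.
move=> r0 cot am bm ga hb long; have r4 : 0 <= 4 * rho by lra.
have [near|far] := ltP (dist a b) (4 * rho).
  exists [set a; b], [set a; b]; split.
  - by move=> c [->|->]; rewrite ?distxx// (distC genS) ltW.
  - by move=> c [->|->]; rewrite ?distxx// ltW.
  have exab c : [set a; b] c -> branch_ex [set c] `<=` branch_ex [set a; b].
    by move=> cab k [sg gsg [z [sz zc]]]; exists sg => //; exists z; rewrite zc in sz *.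
  have gA : branch_ex [set a; b] g by apply: (exab a) => //; left.
  have hA : branch_ex [set a; b] h by apply: (exab b) => //; right.
  have tr (L : unit -> set G) : trivIset setT L by move=> [] [].
  have Am (i : unit) : [set a; b] `<=` sphere m by move=> c [->|->].
  have eps1 (i : unit) : `|1 : C| <= 1 by rewrite normr1.
  have := cotlar_property_symbol cot Am (tr _) eps1 (i := tt) (j := tt) gA hA long.
  (* If both memberships failed, the right side would vanish, while the left side is 1. *)
  move=> H; apply: contrapT => /not_orP[kA kB]; move/eqP: H.
  rewrite !(@symbol_notin _ _ _ _ _ (g / h)%g)// !(@symbol_notin _ _ _ _ _ (h / g)%g)//.
  rewrite (symbol_disjoint _ (tr _) (i := tt) gA) (symbol_disjoint _ (tr _) (i := tt) hA).
  by rewrite rmorph0 rmorph1 !mul0r !mulr0 mulr1 addr0 subr0 oner_eq0.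
exists [set a], [set b]; split; [by move=> c ->; rewrite distxx | by move=> c ->; rewrite distxx |].
have dis := branch_all_disjoint genS r0 am bm far.
pose A (i : bool) := if i then [set a] else [set b].
have Am i : A i `<=` sphere m by case: i => c ->.
have tA : trivIset setT (fun i => branch_all rho (A i)).
  move=> [] [] _ _ //= [c]; first by rewrite dis.
  by rewrite setIC dis.
(* If both fail, [b] alone contributes to the symbol at [g / h] and [a] alone to that at [h / g],
   which gives the right side the shape excluded by [cotlar_polarization]. *)
apply: contrapT => /not_orP[kA kB].
suff : (4%:R : C) = 0 by move/eqP; rewrite pnatr_eq0.
apply: (@cotlar_polarization C 'i
  (h \in branch_ex [set a])%:R (g \in branch_ex [set b])%:R
  (g / h \in branch_all rho [set b])%g%:R
  (h \in branch_all rho [set a])%:R (h \in branch_all rho [set b])%:R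
  (g \in branch_all rho [set a])%:R (g \in branch_all rho [set b])%:R
  (h / g \in branch_all rho [set a])%g%:R (mulCii _)) => e e' ee.
have cNi : (- 'i : C)^* = 'i by rewrite -conjCi conjCK.
have [ne ce] : `|e| <= 1 /\ e^* = e'.
  by move: ee; rewrite !inE => /or4P[] /eqP[-> ->];
    rewrite ?normrN ?normr1 ?normCi ?cNi ?conjCi ?rmorphN ?rmorph1.
have cE (x y : bool) : (1 * x%:R + e * y%:R)^* = x%:R + e' * y%:R :> C.
  by rewrite -ce rmorphD !rmorphM rmorph1 !rmorph_nat mul1r.
have eps1 (i : bool) : `|if i then 1 else e| <= 1 by case: i => //; rewrite normr1.
have := cotlar_property_symbol cot Am tA eps1 (i := true) (j := false) ga hb long.
rewrite /symbol !big_bool /= !cE (mem_set ga) (mem_set hb) (memNset kA) (memNset kB).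
by rewrite !mulr1 !mulr0 !mul1r add0r addr0 => ->; ring.
Qed.

Lemma path_geodesic_mull g p n x y : path_geodesic wd p n x y ->
  path_geodesic wd (fun i => g * p i)%g n (g * x)%g (g * y)%g.
Proof. by case=> <- <- h; split=> // i j ij; rewrite word_dist_mull h. Qed.

(** Translating [x], respectively [z], to the identity turns the triangle into [g = x^-1 * y] and
    [h = z^-1 * y], with [g * h^-1 = x^-1 * z]. The constant is [rho + 1] from a vertex of the path
    to a point of the set, plus [4 * rho] from there to [a] or [b]. *)
Lemma cotlar_property_scale (rho : R) m r : 0 < rho -> 5 * rho + 1 <= r%:R ->
  cotlar_property S rho m -> cotlar_scale wd r m.
Proof.
move=> r0 rr cot x y z a b p n xa xay zb zby xz gp.
have gm := word_dist_geodesic genS; have [_ dC _ _] := gm.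
have sph u w : wd u w = m -> sphere m (vertex R S (u^-1 * w)%g).
  move=> uw; rewrite /sphere /= (dist_vertex R genS) dC.
  by rewrite -(mulVg u) word_dist_mull uw.
have brex u w v : (wd u w + wd w v = wd u v)%N ->
    branch_ex [set vertex R S (u^-1 * w)%g] (u^-1 * v)%g.
  move=> uwv; apply: (@branch_ex_between R G S genS _ (u^-1 * w)%g) => //.
  by rewrite -(mulVg u) !word_dist_mull.
have kE : (x^-1 * y * (z^-1 * y)^-1 = x^-1 * z)%g by rewrite invgM invgK mulgA mulgK.
have kE' : (z^-1 * y * (x^-1 * y)^-1 = z^-1 * x)%g by rewrite invgM invgK mulgA mulgK.
have [|A [B [Aa Bb alt]]] := cotlar_property_branch r0 cot (sph _ _ xa) (sph _ _ zb)
    (brex _ _ _ xay) (brex _ _ _ zby).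
  rewrite kE (len_word_dist R genS) -(mulVg x) word_dist_mull.
  by move: xz; rewrite -(ler_nat R) natrD natrM; lra.
have close u c q l w D : path_geodesic wd q l u w ->
    (forall c', D c' -> dist c' (vertex R S (u^-1 * c)%g) <= 4 * rho) ->
    branch_all rho D (u^-1 * w)%g -> exists2 i, (i <= l)%N & (wd (q i) c <= r)%N.
  move=> gq Dc bD; have := path_geodesic_mull u^-1%g gq; rewrite mulVg => gq'.
  have [c' Dc' [i il hi]] := branch_all_near r0 bD gq'; exists i => //.
  rewrite -(ler_nat R) -(word_dist_mull genS u^-1%g) -(dist_vertex R genS).
  have := distT genS c' (vertex R S (u^-1 * q i)%g) (vertex R S (u^-1 * c)%g).
  by have := Dc _ Dc'; lra.
rewrite kE kE' in alt; case: alt => [xA|zB].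
  by have [i il hi] := close _ _ _ _ _ _ gp Aa xA; exists i => //; left.
have [i il hi] := close _ _ _ _ _ _ (path_geodesic_rev gm gp) Bb zB.
by exists (n - i)%N; [exact: leq_subr | right].
Qed.
End Converse.

Theorem theoremB (R : realType) (G : groupType) (S : set G)
    (finS : finite_set S) (genS : generates S) :
  hyperbolic R S <->
  exists2 rho : R, 0 < rho & exists m : nat -> nat,
    [/\ (forall k, 0 < m k)%N /\ {homo m : i j / (i < j)%N},
        m k @[k --> \oo] --> \oo,
        (ereal_sup (range (fun k => ((m k.+1)%:R / (m k)%:R : R)%:E)) < +oo)%E
      & forall k, cotlar_property S rho (m k)].
Proof.
split=> [[delta hyp]|[rho r0 [m [[_ m_incr] _ _ cot]]]].
  (* The maximum ensures both positivity and [delta <= rho]; all scales then work, and [m k = k + 1]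
     has successive ratios at most 2. *)
  exists (Num.max delta 1); first by rewrite lt_max ltr01 orbT.
  exists succn; split.
  - by split.
  - exact: (@cvg_addnl 1).
  - apply: (@le_lt_trans _ _ 2%:E); last exact: ltry.
    apply: ge_ereal_sup => _ [k _ <-]; rewrite lee_fin ler_pdivrMr ?ltr0Sn//.
    by rewrite -natrM ler_nat; lia.
  - by move=> k; apply: hyperbolic_cotlar hyp _ _ => //; rewrite ?le_max ?lt_max ?lexx ?ltr01 ?orbT.
(* Strict growth supplies a scale above any given bound. *)
have m_ge k : (k <= m k)%N.
  elim: k => // k IH; apply: leq_ltn_trans IH _; exact: m_incr.
have [r hr] : exists r : nat, 5 * rho + 1 <= r%:R.
  exists (Num.truncn (5 * rho + 1)).+1; exact/ltW/truncnS_gt.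
have [|Delta slim] := cotlar_scale_slim (word_dist_geodesic genS) (r := r).
  by move=> c; exists (m c) => //; apply: cotlar_property_scale (cot c).
exact: slim_triangles_hyperbolic slim.
Qed.
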